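(* Let $n\in\mathbb{N}$, let $G$ be a finite group and let $\lambda\in H^2(G,\mathbb{T})$. Then there exists a projective representation $u:G\to P\mathcal{U}(M_{n^\infty})$ with $\mathrm{ob}(u)=\lambda$ if and only if $\lambda^{n^k}=1$ for some $k\in\mathbb{N}$.
   Context: $M_{n^\infty}=\bigotimes_{\mathbb{N}}M_n(\mathbb{C})$ is the UHF algebra of infinite type $n^\infty$. For a unital C$^*$-algebra $A$, $\mathcal{U}(A)$ is its unitary group with the norm topology and $P\mathcal{U}(A)=\mathcal{U}(A)/\mathbb{T}$. A projective representation of $G$ on $A$ is a group homomorphism $u:G\to P\mathcal{U}(A)$; for a lift $\tilde u:G\to\mathcal{U}(A)$, $\tilde u_g\tilde u_h\tilde u_{gh}^*\in\mathbb{T}$ is a 2-cocycle whose class $\mathrm{ob}(u)\in H^2(G,\mathbb{T})$ is independent of the lift. The group $H^2(G,\mathbb{T})$ is written multiplicatively. *)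

(* Defs.v *)
From HB Require Import structures.
From mathcomp Require Import all_boot all_order all_algebra all_fingroup.
From mathcomp Require Import complex mxtens.
From mathcomp Require Import reals.

Set Implicit Arguments.
Unset Strict Implicit.
Unset Printing Implicit Defensive.

Import Order.TTheory GRing.Theory Num.Theory.
Local Open Scope ring_scope.

Section UHF.
Variable R : realType.
Local Notation C := (R[i]).

Definition cabs2 (z : C) : R := (complex.Re z) ^+ 2 + (complex.Im z) ^+ 2.

Definition cnorm2 m (v : 'cV[C]_m) : R := \sum_(i < m) cabs2 (v i 0).

Definition opnorm_le m (A : 'M[C]_m) (e : R) : Prop :=
  forall v : 'cV[C]_m, cnorm2 (A *m v) <= e ^+ 2 * cnorm2 v.

Definition adjmx m (A : 'M[C]_m) : 'M[C]_m := (map_mx (@conjc R) A)^T.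

Variable n : nat.

(** [dim k] = n ^ k, defined recursively so that the connecting maps typecheck *)
Fixpoint dim (k : nat) : nat := if k is k'.+1 then n * dim k' else 1%N.

Lemma dimE k : dim k = (n ^ k)%N.
Proof. by elim: k => //= k ->; rewrite expnS. Qed.

Definition up1 k (A : 'M[C]_(dim k)) : 'M[C]_(dim k.+1) := (1%:M : 'M[C]_n) *t A.

Fixpoint up_by k (d : nat) : 'M[C]_(dim k) -> 'M[C]_(dim (d + k)) :=
  match d with
  | 0 => fun A => A
  | d'.+1 => fun A => up1 (up_by d' A)
  end.

(** A "level sequence": a_k in M_{n^k}(C).  Elements of the UHF algebra
    M_{n^oo} (the C*-completion of the union of the M_{n^k}) are represented
    by Cauchy level sequences, up to the equivalence [uhf_eq]. *)
Definition lvlseq := forall k : nat, 'M[C]_(dim k).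

Definition uhf_cauchy (a : lvlseq) : Prop :=
  forall e : R, 0 < e -> exists N : nat, forall k d : nat, (N <= k)%N ->
    opnorm_le (up_by d (a k) - a (d + k)%N) e.

Definition uhf_eq (a b : lvlseq) : Prop :=
  forall e : R, 0 < e -> exists N : nat, forall k : nat, (N <= k)%N ->
    opnorm_le (a k - b k) e.

Definition uhf_mul (a b : lvlseq) : lvlseq := fun k => a k *m b k.
Definition uhf_adj (a : lvlseq) : lvlseq := fun k => adjmx (a k).
Definition uhf_scale (c : C) (a : lvlseq) : lvlseq := fun k => c *: a k.
Definition uhf_one : lvlseq := fun k => 1%:M.

Definition uhf_unitary (u : lvlseq) : Prop :=
  uhf_cauchy u /\ uhf_eq (uhf_mul (uhf_adj u) u) uhf_one
               /\ uhf_eq (uhf_mul u (uhf_adj u)) uhf_one.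

Variable gT : finGroupType.

(** projective representation G -> PU(M_{n^oo}), given through a lift
    u : G -> U(M_{n^oo}): u_g u_h is a scalar of modulus 1 times u_{gh}. *)
Definition proj_rep (u : gT -> lvlseq) : Prop :=
  (forall g, uhf_unitary (u g)) /\
  forall g h, exists c : C, cabs2 c = 1 /\
    uhf_eq (uhf_mul (u g) (u h)) (uhf_scale c (u (g * h)%g)).

Definition is_cocycle (w : gT -> gT -> C) : Prop :=
  (forall g h, cabs2 (w g h) = 1) /\
  forall g h k, w g h * w (g * h)%g k = w h k * w g (h * k)%g.

Definition cohomologous (w w' : gT -> gT -> C) : Prop :=
  exists b : gT -> C, (forall g, cabs2 (b g) = 1) /\
    forall g h, w' g h = w g h * (b g * b h / b (g * h)%g).

Definition ob_is (u : gT -> lvlseq) (w : gT -> gT -> C) : Prop :=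
  exists c : gT -> gT -> C,
    (forall g h, cabs2 (c g h) = 1 /\
       uhf_eq (uhf_mul (u g) (u h)) (uhf_scale (c g h) (u (g * h)%g))) /\
    cohomologous c w.

End UHF.

(* Main.v *)
Require Import Defs.
From HB Require Import structures.
From mathcomp Require Import all_boot all_order all_algebra all_fingroup.
From mathcomp Require Import complex mxtens.
From mathcomp Require Import reals.
From mathcomp Require Import pgroup sylow sesquilinear spectral ring.

(** Fix a cocycle [w] representing the class.  If [u] realises it, then at a
    high enough level [k] the matrices [u_g(k)] form an approximate [w]-twisted
    representation of dimension [N = n ^ k].  It can be corrected to an exact
    one of the same dimension: [x |-> (u_h(k) x)_h] approximately embeds it in
    a multiple [L] of the regular twisted representation; averaging the range
    of this embedding over [G] gives a Hermitian matrix commuting with [L],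
    whose eigenvalues [>= 1/2] span an invariant subspace of dimension exactly
    [N].  Determinants then give [w ^ N ~ 1].

    Conversely, the dimensions of [w]-twisted representations form an additive
    monoid.  For a prime [q] not dividing [n], the class of [w] is trivial on a
    Sylow [q]-subgroup [Q], its order there dividing both [n ^ k] and [#|Q|];
    induction from [Q] gives a dimension prime to [q].  Hence the monoid
    contains a power [n ^ j], and a representation of that dimension is
    constant from level [j] on.  The cases [n = 0] and [n = 1] are direct. *)

Set Implicit Arguments.
Unset Strict Implicit.
Unset Printing Implicit Defensive.

Import Order.TTheory GRing.Theory Num.Theory.
Local Open Scope ring_scope.
Local Open Scope sesquilinear_scope.

(** * Squared Euclidean norms, adjoints and kernel vectors *)

Section SquaredNorm.
Variable C : numClosedFieldType.

Definition sqn m (v : 'cV[C]_m) : C := \sum_i `|v i 0| ^+ 2.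

Lemma sqn_ge0 m (v : 'cV_m) : 0 <= sqn v.
Proof. by apply: sumr_ge0 => i _; rewrite exprn_ge0. Qed.

Lemma sqn_eq0 m (v : 'cV_m) : (sqn v == 0) = (v == 0).
Proof.
apply/idP/eqP => [|->]; last first.
  by rewrite /sqn big1 // => i _; rewrite mxE normr0 expr0n.
rewrite psumr_eq0 => [/allP v0|i _]; last exact: exprn_ge0.
apply/colP => i; rewrite mxE; apply/eqP.
by have := v0 i (mem_index_enum i); rewrite sqrf_eq0 normr_eq0.
Qed.

Lemma sqnE m (v : 'cV_m) : sqn v = (v^t* *m v) 0 0.
Proof. by rewrite mxE; apply: eq_bigr => i _; rewrite !mxE mulrC normCK. Qed.

Lemma sqnZ m c (v : 'cV_m) : sqn (c *: v) = `|c| ^+ 2 * sqn v.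
Proof.
by rewrite mulr_sumr; apply: eq_bigr => i _; rewrite mxE normrM exprMn.
Qed.

Lemma trmxC_mul m n p (A : 'M[C]_(m, n)) (B : 'M_(n, p)) :
  (A *m B)^t* = B^t* *m A^t*.
Proof. by rewrite trmx_mul map_mxM. Qed.

Lemma sqn_mul m n (A : 'M_(m, n)) (v : 'cV_n) :
  sqn (A *m v) = (v^t* *m (A^t* *m A *m v)) 0 0.
Proof. by rewrite sqnE trmxC_mul !mulmxA. Qed.

Lemma sqn_isometry m n (A : 'M_(m, n)) (v : 'cV_n) :
  A^t* *m A = 1%:M -> sqn (A *m v) = sqn v.
Proof. by move=> AA; rewrite sqn_mul AA mul1mx -sqnE. Qed.

Lemma sqn_CauchySchwarz m (u v : 'cV_m) :
  `|(u^t* *m v) 0 0| ^+ 2 <= sqn u * sqn v.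
Proof.
have : `|dotmx v^T u^T| ^+ 2 <= dotmx v^T v^T * dotmx u^T u^T.
  by case: (CauchySchwarz (@dotmx C m) v^T u^T).
rewrite !dotmxE !trmxK.
have E (x y : 'cV[C]_m) : (x^T *m map_mx Num.conj y) 0 0 = (y^t* *m x) 0 0.
  by rewrite !mxE; apply: eq_bigr => i _; rewrite !mxE mulrC.
by rewrite !E -!sqnE mulrC.
Qed.

(** Cauchy-Schwarz applied to [sqn x = <v, A x>] with [x = A^t* *m v], after which one factor
    [sqn x] cancels. *)
Lemma sqn_adj_bound m n (A : 'M_(m, n)) e : 0 <= e ->
  (forall v, sqn (A *m v) <= e * sqn v) ->
  forall v, sqn (A^t* *m v) <= e * sqn v.
Proof.
move=> e0 He v; set x := A^t* *m v.
have [/eqP->|x0] := boolP (sqn x == 0); first by rewrite mulr_ge0 ?sqn_ge0.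
have xgt0 : 0 < sqn x by rewrite lt_def x0 sqn_ge0.
have E : sqn x = (v^t* *m (A *m x)) 0 0.
  by rewrite sqnE {1}/x trmxC_mul trmxCK !mulmxA.
have := sqn_CauchySchwarz v (A *m x).
rewrite -E ger0_norm ?sqn_ge0 // => H.
rewrite -(ler_pM2r xgt0); apply: le_trans (_ : _ <= sqn v * sqn (A *m x)) _.
  by rewrite -expr2.
by rewrite (mulrC e) -mulrA ler_wpM2l ?sqn_ge0 ?He.
Qed.

Lemma exists_kernel_vector (F : fieldType) m n (A : 'M[F]_(m, n)) :
  (m < n)%N -> exists2 v : 'cV_n, v != 0 & A *m v = 0.
Proof.
move=> mn; have : kermx A^T != 0.
  rewrite -mxrank_eq0 mxrank_ker mxrank_tr subn_eq0 -ltnNge.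
  exact: leq_ltn_trans (rank_leq_row A) mn.
case/rowV0Pn => u /sub_kermxP uA u0; exists u^T; last first.
  by rewrite -[A]trmxK -trmx_mul uA trmx0.
by rewrite -trmx0 (inj_eq trmx_inj).
Qed.

End SquaredNorm.

(** * Twisted representations, and spectral rounding of an almost invariant subspace *)

Section ExactRepresentations.
Variables (C : numClosedFieldType) (gT : finGroupType).
Implicit Types w : gT -> gT -> C.

Definition twisted_rep w r (S : gT -> 'M[C]_r) : Prop :=
  (forall g, S g \is unitarymx) /\
  forall g h, S g *m S h = w g h *: S (g * h)%g.

Lemma unitary_adjl r (S : 'M[C]_r) : S \is unitarymx -> S^t* *m S = 1%:M.
Proof. by rewrite -trmxC_unitary => /unitarymxP; rewrite trmxCK. Qed.

Lemma twisted_rep1 w r (S : gT -> 'M[C]_r) :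
  twisted_rep w S -> S 1%g = w 1%g 1%g *: 1%:M.
Proof.
case=> US MS; have := MS 1%g 1%g; rewrite mulg1.
move/(congr1 (fun A => A *m (S 1%g)^t*)).
by rewrite -scalemxAl -mulmxA (unitarymxP (US _)) mulmx1.
Qed.

Lemma normM_conj (x : C) : `|x| = 1 -> x * x^* = 1.
Proof. by move=> x1; rewrite -normCK x1 expr1n. Qed.

Section Rounding.
Variables (M N : nat) (w : gT -> gT -> C) (L : gT -> 'M[C]_M).
Variables (V : 'M[C]_(M, N)) (e : C).
Hypotheses (w1 : forall g h, `|w g h| = 1) (L_rep : twisted_rep w L).
Hypotheses (V_lower : forall x, 2^-1 * sqn x <= sqn (V *m x)).
Hypotheses (V_near : forall f, V^t* *m f = 0 ->
  forall g, sqn (V^t* *m ((L g)^t* *m f)) <= e * sqn f).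
Hypothesis e_small : #|gT|%:R * e < 2^-1.

(** The sum is not divided by [#|gT|]; the cut at [2^-1] and [e_small] are tuned to this
    normalisation. *)
Let P : 'M[C]_M := \sum_g (L g *m V) *m (L g *m V)^t*.

Let P_herm : P^t* = P.
Proof.
rewrite /P linear_sum /= map_mx_sum; apply: eq_bigr => g _.
by rewrite trmxC_mul trmxCK.
Qed.

Let P_form (f : 'cV_M) :
  (f^t* *m (P *m f)) 0 0 = \sum_g sqn (V^t* *m ((L g)^t* *m f)).
Proof.
rewrite /P mulmx_suml mulmx_sumr summxE; apply: eq_bigr => g _.
by rewrite sqnE !trmxC_mul !trmxCK !mulmxA.
Qed.

(** Conjugation by [L h] translates the summation index; the scalars [w h g] have modulus one and
    cancel against their conjugates. *)
Let P_comm h : L h *m P = P *m L h.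
Proof.
have [UL ML] := L_rep.
suff E : L h *m P *m (L h)^t* = P.
  by rewrite -{2}E -!mulmxA (unitary_adjl (UL h)) mulmx1.
rewrite /P mulmx_sumr mulmx_suml [RHS](reindex_inj (mulgI h)) /=.
apply: eq_bigr => g _.
have -> : L h *m (L g *m V *m (L g *m V)^t*) *m (L h)^t* =
          (L h *m (L g *m V)) *m (L h *m (L g *m V))^t*.
  by rewrite [in RHS]trmxC_mul !mulmxA.
rewrite mulmxA ML -scalemxAl linearZ map_mxZ -scalemxAl -scalemxAr scalerA.
by rewrite normM_conj ?scale1r.
Qed.

Let V_neq0 (x : 'cV_N) : x != 0 -> V *m x != 0.
Proof.
move=> x0; rewrite -sqn_eq0; apply: contraNneq x0 => Vx0.
have := V_lower x; rewrite Vx0 pmulr_rle0 ?invr_gt0 ?ltr0n // => H.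
by rewrite -sqn_eq0 eq_le H sqn_ge0.
Qed.

(** The term [g = 1] suffices: [L 1] is a scalar of modulus one, and Cauchy-Schwarz gives
    [sqn (V x) ^+ 2 <= sqn x * sqn (V^t* V x)], to be combined with [V_lower]. *)
Let P_on_range (x : 'cV_N) : 2^-1 * sqn (V *m x) <=
  ((V *m x)^t* *m (P *m (V *m x))) 0 0.
Proof.
rewrite P_form (bigD1 1%g) //=; apply: ler_wpDr.
  by apply: sumr_ge0 => *; exact: sqn_ge0.
have [->|x0] := eqVneq x 0.
  by rewrite !mulmx0 /sqn big1 ?mulr0 ?big1 // => i _; rewrite mxE normr0 expr0n.
have -> : sqn (V^t* *m ((L 1%g)^t* *m (V *m x))) = sqn (V^t* *m (V *m x)).
  rewrite (twisted_rep1 L_rep) linearZ /= map_mxZ trmx1 map_mx1.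
  by rewrite -scalemxAl mul1mx -scalemxAr sqnZ norm_conjC w1 expr1n mul1r.
have xgt0 : 0 < sqn x by rewrite lt_def sqn_ge0 sqn_eq0 x0.
rewrite -(ler_pM2l xgt0).
have := sqn_CauchySchwarz x (V^t* *m (V *m x)).
have -> : (x^t* *m (V^t* *m (V *m x))) 0 0 = sqn (V *m x).
  by rewrite sqnE trmxC_mul !mulmxA.
rewrite ger0_norm ?sqn_ge0 //; apply: le_trans.
by rewrite mulrCA mulrA expr2 ler_wpM2r ?sqn_ge0 ?V_lower.
Qed.

(** Each of the [#|gT|] terms is at most [e * sqn f]. Strictness here, against the weak bound on the
    range, makes [2^-1] a valid spectral cut. *)
Let P_on_kernel (f : 'cV_M) : V^t* *m f = 0 -> f != 0 ->
  (f^t* *m (P *m f)) 0 0 < 2^-1 * sqn f.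
Proof.
move=> Vf f0; rewrite P_form.
have fgt0 : 0 < sqn f by rewrite lt_def sqn_ge0 sqn_eq0 f0.
apply: le_lt_trans (_ : _ <= #|gT|%:R * e * sqn f) _.
  rewrite -mulrA mulr_natl -sumr_const; apply: ler_sum => g _; exact: V_near.
by rewrite ltr_pM2r.
Qed.

Let S := spectralmx P.
Let d := spectral_diag P.
Let big i := 2^-1 <= d 0 i.

Let US : S \is unitarymx. Proof. exact: spectral_unitarymx. Qed.

Let P_diag : P = S^t* *m diag_mx d *m S.
Proof.
have: P \is normalmx by apply/normalmxP; rewrite P_herm.
by move/orthomx_spectralP; rewrite -invmx_unitary.
Qed.

Let SPS : diag_mx d = S *m P *m S^t*.
Proof.
by rewrite P_diag !mulmxA (unitarymxP US) mul1mx -mulmxA (unitarymxP US) mulmx1.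
Qed.

(** The order on [C] is partial, so negating [big] requires real eigenvalues; each is a value of the
    form of [P], a sum of squared norms. *)
Let d_real i : d 0 i \is Num.real.
Proof.
have -> : d 0 i = (((row i S)^t*)^t* *m (P *m (row i S)^t*)) 0 0.
  transitivity ((diag_mx d) i i); first by rewrite mxE eqxx mulr1n.
  rewrite SPS trmxCK mulmxA -row_mul; rewrite [LHS]mxE [RHS]mxE.
  by apply: eq_bigr => j _; rewrite !mxE.
by rewrite P_form; apply: ger0_real; apply: sumr_ge0 => *; exact: sqn_ge0.
Qed.

Let P_coords (f : 'cV_M) :
  (f^t* *m (P *m f)) 0 0 = \sum_i d 0 i * `|(S *m f) i 0| ^+ 2.
Proof.
rewrite P_diag.
have -> : f^t* *m (S^t* *m diag_mx d *m S *m f) =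
  (S *m f)^t* *m (diag_mx d *m (S *m f)) by rewrite trmxC_mul !mulmxA.
rewrite mxE; apply: eq_bigr => i _; rewrite mul_diag_mx [X in _ * X]mxE !mxE.
by rewrite mulrCA; congr (_ * _); rewrite mulrC -normCK.
Qed.

(* [V] maps no nonzero vector into the span of the small eigenvectors, and no
   nonzero combination of big eigenvectors is orthogonal to the range of [V]. *)
Let card_big : #|big| = N.
Proof.
have sqS f : sqn (S *m f) = sqn f by apply/sqn_isometry/unitary_adjl/US.
apply/eqP; rewrite eqn_leq; apply/andP; split; rewrite leqNgt; apply/negP.
- move=> lt; pose J : 'M[C]_(M, #|big|) := \matrix_(i, j) (i == enum_val j)%:R.
  have [y y0 Vy] := exists_kernel_vector (V^t* *m S^t* *m J) lt.
  pose f := S^t* *m (J *m y).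
  have Sf : S *m f = J *m y by rewrite /f mulmxA (unitarymxP US) mul1mx.
  have Jy j : (J *m y) (enum_val j) 0 = y j 0.
    rewrite mxE (bigD1 j) //= mxE eqxx mul1r big1 ?addr0 // => k kj.
    by rewrite mxE (inj_eq enum_val_inj) eq_sym (negPf kj) mul0r.
  have Jy0 i : ~~ big i -> (J *m y) i 0 = 0.
    move=> bi; rewrite mxE big1 // => k _; rewrite mxE.
    case: eqP => [E|]; last by rewrite mul0r.
    by move: bi; rewrite E => /negP[]; exact: (enum_valP k).
  have f0 : f != 0.
    apply: contra_neq y0 => f0; apply/colP => j.
    by rewrite -Jy -Sf f0 mulmx0 !mxE.
  have Vf : V^t* *m f = 0 by rewrite /f !mulmxA.
  have := P_on_kernel Vf f0; rewrite P_coords -sqS Sf mulr_sumr.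
  apply/negP; rewrite -real_leNgt; last first.
  + by apply: rpred_sum => i _; rewrite rpredM ?d_real ?rpredX ?normr_real.
  + by apply: rpred_sum => i _; rewrite rpredM ?rpredV ?rpred_nat ?rpredX
       ?normr_real.
  apply: ler_sum => i _; have [bi|/Jy0->] := boolP (big i); last first.
    by rewrite normr0 expr0n !mulr0.
  by rewrite ler_wpM2r ?exprn_ge0.
- move=> lt; pose J : 'M[C]_(#|big|, M) := \matrix_(j, i) (i == enum_val j)%:R.
  have [x x0 Jx] := exists_kernel_vector (J *m S *m V) lt.
  pose f := V *m x.
  have f0 : f != 0 by exact: V_neq0.
  have Sf0 i : big i -> (S *m f) i 0 = 0.
    move=> bi; have bi' : i \in big by [].
    have := congr1 (fun A : 'cV_#|big| => A (enum_rank_in bi' i) 0) Jx.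
    rewrite -!mulmxA mxE [in RHS]mxE (bigD1 i) //= mxE enum_rankK_in // eqxx mul1r.
    rewrite big1 ?addr0 // => k ki; rewrite mxE enum_rankK_in //.
    by rewrite (negPf ki) mul0r.
  have := P_on_range x; rewrite -/f P_coords -sqS mulr_sumr.
  apply/negP; rewrite -real_ltNge; last first.
  + by apply: rpred_sum => i _; rewrite rpredM ?rpredV ?rpred_nat ?rpredX
       ?normr_real.
  + by apply: rpred_sum => i _; rewrite rpredM ?d_real ?rpredX ?normr_real.
  have [i Sfi] : exists i, (S *m f) i 0 != 0.
    apply/existsP; apply: contraNT f0 => /existsPn H.
    rewrite -sqn_eq0 -sqS sqn_eq0; apply/eqP/colP => i.
    by rewrite [RHS]mxE; apply/eqP; move: (H i); rewrite negbK.
  have nbig k : ~~ big k -> d 0 k < 2^-1.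
    by rewrite /big -real_ltNge ?rpredV ?rpred_nat ?d_real.
  rewrite (bigD1 i) //= [ltRHS](bigD1 i) //=; apply: ltr_leD.
    rewrite ltr_pM2r ?exprn_gt0 ?normr_gt0 //; apply: nbig.
    by apply: contra Sfi => /Sf0 ->.
  apply: ler_sum => k _; have [/Sf0->|bk] := boolP (big k).
    by rewrite normr0 expr0n !mulr0.
  by rewrite ler_wpM2r ?exprn_ge0 // ltW ?nbig.
Qed.

(** In an eigenbasis of [P] every [L g] is block diagonal along [big]; by [card_big] the block of
    big indices has size [N], and it is the required representation. *)
Lemma round_to_twisted_rep : exists B : gT -> 'M[C]_N, twisted_rep w B.
Proof.
have [UL ML] := L_rep.
pose X g := S *m L g *m S^t*.
have UX g : X g *m (X g)^t* = 1%:M.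
  apply/unitarymxP; rewrite /X !mul_unitarymx ?trmxC_unitary //.
have Xcomm g : X g *m diag_mx d = diag_mx d *m X g.
  rewrite SPS /X -!mulmxA; congr (_ *m _).
  rewrite !(mulmxA (S^t*) S) (unitary_adjl US) !mul1mx.
  by rewrite !mulmxA P_comm.
have Xoff g i j : big i != big j -> X g i j = 0.
  move=> bij; have := congr1 (fun A : 'M_M => A i j) (Xcomm g).
  rewrite mul_mx_diag mul_diag_mx !mxE mulrC => /eqP.
  rewrite -subr_eq0 -mulrBl mulf_eq0 => /orP[|/eqP//].
  by rewrite subr_eq0 => /eqP E; move: bij; rewrite /big E eqxx.
pose f (i : 'I_N) : 'I_M := enum_val (cast_ord (esym card_big) i).
have f_inj : injective f by move=> i j /enum_val_inj/cast_ord_inj.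
have bigf i : big (f i) by exact: (enum_valP (cast_ord (esym card_big) i)).
have sum_big (F : 'I_M -> C) :
    (forall k, ~~ big k -> F k = 0) -> \sum_k F k = \sum_i F (f i).
  move=> F0; rewrite (bigID big) /= [X in _ + X]big1 ?addr0; last by move=> k /F0.
  rewrite (big_enum_val F) (reindex (cast_ord (esym card_big))) //=.
  by exists (cast_ord card_big) => i _; rewrite ?cast_ordK ?cast_ordKV.
exists (fun g => mxsub f f (X g)); split=> [g|g h].
- apply/unitarymxP/matrixP => i j.
  transitivity ((X g *m (X g)^t*) (f i) (f j)).
    rewrite !mxE sum_big => [|k bk]; first by apply: eq_bigr => k _; rewrite !mxE.
    by rewrite Xoff ?mul0r // bigf (negPf bk).
  by rewrite UX !mxE (inj_eq f_inj).
- have XM : X g *m X h = w g h *: X (g * h)%g.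
    rewrite /X -!mulmxA (mulmxA (S^t*) S) (unitary_adjl US) mul1mx.
    by rewrite (mulmxA (L g)) ML -scalemxAl -scalemxAr.
  apply/matrixP => i j; transitivity ((X g *m X h) (f i) (f j)).
    rewrite !mxE sum_big => [|k bk]; first by apply: eq_bigr => k _; rewrite !mxE.
    by rewrite Xoff ?mul0r // bigf (negPf bk).
  by rewrite XM !mxE.
Qed.
End Rounding.
End ExactRepresentations.

(** * Monomial twisted representations *)

Section MonomialRepresentations.
Variables (C : numClosedFieldType) (gT : finGroupType).
Implicit Types w : gT -> gT -> C.

(** The operator [f |-> (x |-> alpha g x * f (act g x))] on functions on [X]; it covers both the
    twisted regular representation and induced ones. *)
Definition twisted_mx (X : finType) (act : gT -> X -> X) (alpha : gT -> X -> C)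
    (g : gT) : 'M[C]_#|X| :=
  \matrix_(i, j) (alpha g (enum_val i) *+ (enum_val j == act g (enum_val i))).

Lemma twisted_mxM (X : finType) (act : gT -> X -> X) (alpha : gT -> X -> C) g p
    (A : 'M[C]_(#|X|, p)) i j :
  (twisted_mx act alpha g *m A) i j =
  alpha g (enum_val i) * A (enum_rank (act g (enum_val i))) j.
Proof.
rewrite mxE (bigD1 (enum_rank (act g (enum_val i)))) //= mxE enum_rankK eqxx.
rewrite big1 ?addr0 // => k ki; rewrite mxE.
by rewrite -(inj_eq enum_rank_inj) enum_valK (negPf ki) mul0r.
Qed.

Lemma twisted_mx_rep w (X : finType) (act : gT -> X -> X) (alpha : gT -> X -> C) :
  (forall g, injective (act g)) ->
  (forall g h x, act h (act g x) = act (g * h)%g x) ->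
  (forall g x, `|alpha g x| = 1) ->
  (forall g h x, alpha g x * alpha h (act g x) = w g h * alpha (g * h)%g x) ->
  twisted_rep w (twisted_mx act alpha).
Proof.
move=> actI actM alpha1 alphaM; split=> [g|g h].
  apply/unitarymxP/matrixP => i j; rewrite twisted_mxM !mxE enum_rankK.
  rewrite (inj_eq (actI g)) (inj_eq enum_val_inj).
  case: eqP => [->|_]; last by rewrite mulr0n conjC0 mulr0.
  by rewrite !mulr1n normM_conj.
apply/matrixP => i j; rewrite twisted_mxM !mxE enum_rankK actM mulrnAr alphaM.
by rewrite mulrnAr.
Qed.

End MonomialRepresentations.

(** * From approximate to exact twisted representations *)

Section Rounding.
Variables (C : numClosedFieldType) (gT : finGroupType).
Variables (N : nat) (w : gT -> gT -> C) (a : gT -> 'M[C]_N) (e : C).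
Hypothesis w1 : forall g h, `|w g h| = 1.
Hypothesis w_cocycle :
  forall g h k, w g h * w (g * h)%g k = w h k * w g (h * k)%g.
Hypothesis a_near : forall g h (x : 'cV_N),
  sqn ((a g *m a h - w g h *: a (g * h)%g) *m x) <= e * sqn x.
Hypothesis a_lower : forall x : 'cV_N, 2^-1 * sqn x <= sqn (a 1%g *m x).
Hypothesis e_ge0 : 0 <= e.
Hypothesis e_small : #|gT|%:R * (#|gT|%:R * e) < 2^-1.

Let X := (gT * 'I_N)%type.

Let L : gT -> 'M[C]_#|{: X}| :=
  twisted_mx (fun g (x : X) => ((x.1 * g)%g, x.2)) (fun g x => w x.1 g).

(* [stack a] embeds [C^N] in [C^gT (x) C^N] and almost intertwines [a] with the
   exact representation [L], [(L g f) x = w x g f (x g)]. *)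
Let stack (b : gT -> 'M[C]_N) : 'M[C]_(#|{: X}|, N) :=
  \matrix_(i, j) b (enum_val i).1 (enum_val i).2 j.

Let stackM b (x : 'cV_N) i : (stack b *m x) i 0 =
  (b (enum_val i).1 *m x) (enum_val i).2 0.
Proof. by rewrite !mxE; apply: eq_bigr => j _; rewrite mxE. Qed.

Let sqn_stack b (x : 'cV_N) : sqn (stack b *m x) = \sum_g sqn (b g *m x).
Proof.
rewrite /sqn pair_big /= [RHS](reindex (@enum_val X predT)) /=.
  by apply: eq_bigr => i _; rewrite stackM.
by exists enum_rank => i _; rewrite ?enum_valK ?enum_rankK.
Qed.

Lemma near_twisted_rep_exact : exists B : gT -> 'M[C]_N, twisted_rep w B.
Proof.
have L_rep : twisted_rep w L.
  apply: twisted_mx_rep => [g [x i] [y j] [/mulIg-> ->]//|g h [x i]|//|g h [x i]] /=.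
    by rewrite mulgA.
  by rewrite w_cocycle [RHS]mulrC mulrC.
have [UL ML] := L_rep.
(* Summing the defect over the blocks of the stack costs one factor [#|gT|]; the averaging in [P]
   costs the other one in [e_small]. *)
apply: (@round_to_twisted_rep _ _ _ _ w L (stack a) (#|gT|%:R * e)) => //.
  move=> x; rewrite sqn_stack (bigD1 1%g) //=; apply: ler_wpDr (a_lower x).
  by apply: sumr_ge0 => *; exact: sqn_ge0.
move=> f Vf g.
(* As [f] is orthogonal to the range of [stack a], only the intertwining defect [D] contributes, and
   its adjoint obeys the same bound as [D]. *)
pose D := L g *m stack a - stack a *m a g.
have -> : (stack a)^t* *m ((L g)^t* *m f) = D^t* *m f.
  rewrite /D linearB /= map_mxB !trmxC_mul mulmxBl.
  by rewrite -[X in _ - X]mulmxA Vf mulmx0 subr0 mulmxA.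
apply: sqn_adj_bound => [|x]; first by rewrite mulr_ge0 ?ler0n.
have -> : D = - stack (fun x => a x *m a g - w x g *: a (x * g)%g).
  apply/matrixP => i j; rewrite /D [LHS]mxE twisted_mxM !mxE enum_rankK /= opprB.
  by congr (_ - _); apply: eq_bigr => k _; rewrite !mxE.
rewrite mulNmx -scaleN1r sqnZ normrN normr1 expr1n mul1r sqn_stack.
by rewrite -mulrA mulr_natl -sumr_const; apply: ler_sum => y _; exact: a_near.
Qed.

End Rounding.

Lemma twisted_rep_det (C : numClosedFieldType) (gT : finGroupType)
    (w : gT -> gT -> C) r (S : gT -> 'M[C]_r) :
  twisted_rep w S ->
  exists b : gT -> C, (forall g, `|b g| = 1) /\
    forall g h, 1 = w g h ^+ r * (b g * b h / b (g * h)%g).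
Proof.
case=> US MS.
have dS g : `|\det (S g)| = 1.
  apply/eqP; rewrite -[_ == 1](@eqrXn2 _ 2) ?normr_ge0 // expr1n normCK.
  by rewrite -{2}(det_tr (S g)) -det_map_mx -det_mulmx (unitarymxP (US g)) det1.
have dS0 g : \det (S g) != 0 by rewrite -normr_eq0 dS oner_eq0.
(* Determinants of the twisted relation produce [w g h ^+ r]; inverting them gives the coboundary
   that carries [w ^+ r] to 1. *)
exists (fun g => (\det (S g))^-1); split=> [g|g h].
  by rewrite normfV dS invr1.
have /(congr1 determinant) := MS g h; rewrite det_mulmx detZ => E.
by rewrite invrK -invfM mulrCA -E mulVf ?mulf_neq0.
Qed.

(** * Powers of [n] in an additive monoid of natural numbers *)

Section PowersInMonoids.
Local Open Scope nat_scope.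

(** The exponent [g] is large enough because [logn p g < g <= logn p (n ^ g)] for each prime [p]
    dividing [g]. *)
Lemma dvdn_exp_of_primes g n : 0 < g -> 0 < n ->
  (forall q, prime q -> q %| g -> q %| n) -> g %| n ^ g.
Proof.
move=> g0 n0 H; apply/dvdn_partP => // p; rewrite mem_primes g0 /= => /andP[pp pg].
rewrite p_part pfactor_dvdn ?expn_gt0 ?n0 // lognX.
apply: leq_trans (ltnW (ltn_logl p g0)) _.
by rewrite leq_pmulr // logn_gt0 mem_primes pp n0 H.
Qed.

(** Two elements are found whose gcd has only prime factors of [n], so that it divides a power of
    [n]; a large enough such power is a combination of them with nonnegative coefficients. *)
Lemma power_in_additive_monoid (D : nat -> Prop) (n : nat) : 1 < n ->
  D 0 -> (forall a b, D a -> D b -> D (a + b)) ->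
  (exists2 r, 0 < r & D r) ->
  (forall q, prime q -> ~~ (q %| n) -> exists2 r, D r & ~~ (q %| r)) ->
  exists j, D (n ^ j).
Proof.
move=> n1 D0 DD [r r0 Dr] Dq.
have n0 : 0 < n by exact: ltnW.
have DM a b : D b -> D (a * b).
  by move=> Db; elim: a => // a IH; rewrite mulSn; apply: DD.
have avoid qs : all prime qs ->
    exists2 s, D s & forall q, q \in qs -> ~~ (q %| n) -> ~~ (q %| s).
  elim: qs => [|p qs IH] /=; first by exists 0.
  case/andP=> pp /[dup] qsp /IH[s Ds sP].
  have [ok|/norP[pn]] := boolP ((p %| n) || ~~ (p %| s)).
    exists s => // q; rewrite inE => /orP[/eqP->|/sP//] pn.
    by case/orP: ok => // pn'; rewrite pn' in pn.
  rewrite negbK => ps; have [t Dt pt] := Dq p pp pn.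
  (* [c] is divisible by the other primes of the list but not by [p], so adding [c * t] repairs [p]
     and keeps the other residues. *)
  pose c := \prod_(q <- qs | q != p) q.
  have pc : ~~ (p %| c).
    rewrite /c Euclid_dvd_prod // big_has_cond; apply/hasPn => q qqs /=.
    rewrite negb_and negbK; case: eqP => //= /eqP qp.
    by rewrite dvdn_prime2 ?(allP qsp _ qqs) // eq_sym.
  exists (s + c * t) => [|q qqs qn]; first by apply/DD/DM.
  have [->|qp] := eqVneq q p.
    by rewrite dvdn_addr // Euclid_dvdM // negb_or pc.
  have qqs' : q \in qs by move: qqs; rewrite inE (negPf qp).
  rewrite dvdn_addl ?sP // dvdn_mulr // /c (big_rem q) //= qp.
  exact: dvdn_mulr.
have [s0 Ds0 s0P] := avoid (primes r) (all_prime_primes r).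
(* Adding [r] makes [s] positive without changing residues modulo the primes of [r]. *)
pose s := s0 + r; have Ds : D s by exact: DD.
have s_gt0 : 0 < s by rewrite addn_gt0 r0 orbT.
have g0 : 0 < gcdn s r by rewrite gcdn_gt0 s_gt0.
have gn q : prime q -> q %| gcdn s r -> q %| n.
  move=> qp; rewrite dvdn_gcd => /andP[qs qr]; apply: contraT => qn.
  have := s0P q; rewrite mem_primes qp r0 qr => /(_ isT qn).
  by rewrite -(dvdn_addl _ qr) qs.
have [u v uv _] := egcdnP r s_gt0.
(* The summand [gcdn s r] gives divisibility by the gcd; the summand [r * s] makes [n ^ j] exceed
   [b * s] below. *)
pose j := gcdn s r + r * s.
have /dvdnP[t tE] : gcdn s r %| n ^ j.
  by rewrite expnD dvdn_mulr // dvdn_exp_of_primes.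
(* The Bezout coefficient is reduced modulo [r] to bound [b * s] while keeping [n ^ j - b * s]
   divisible by [r]. *)
pose b := (t * u) %% r.
have bs_le : b * s <= n ^ j.
  apply: (@leq_trans (r * s)); first by rewrite leq_mul2r ltnW ?orbT // ltn_mod.
  apply: (@leq_trans (n ^ (r * s))).
    by rewrite ltnW // ltn_expl.
  by rewrite leq_pexp2l // leq_addl.
have /dvdnP[a aE] : r %| n ^ j - b * s.
  rewrite -eqn_mod_dvd // -(eqn_modDl (t * v * r)) tE -!mulnA -mulnDr -uv.
  by rewrite (mulnA t v) modnMDl (mulnA t u) /b modnMml.
exists j; rewrite -(subnK bs_le) aE.
by apply: DD; apply: DM.
Qed.

End PowersInMonoids.

(** * Dimensions of twisted representations: sums and induction *)

Section TwistedDimensions.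
Variables (C : numClosedFieldType) (gT : finGroupType) (w : gT -> gT -> C).
Hypothesis w1 : forall g h, `|w g h| = 1.
Hypothesis w_cocycle :
  forall g h k, w g h * w (g * h)%g k = w h k * w g (h * k)%g.

Definition twisted_dim r := exists S : gT -> 'M[C]_r, twisted_rep w S.

Lemma twisted_dim0 : twisted_dim 0.
Proof.
exists (fun=> 0); split=> [g|g h]; last by apply/matrixP=> -[].
by apply/unitarymxP/matrixP=> -[].
Qed.

Lemma twisted_dimD r s : twisted_dim r -> twisted_dim s -> twisted_dim (r + s).
Proof.
move=> [A [UA MA]] [B [UB MB]]; exists (fun g => block_mx (A g) 0 0 (B g)).
split=> [g|g h].
  apply/unitarymxP; rewrite tr_block_mx map_block_mx !trmx0 !map_mx0 mulmx_block.
  rewrite !mulmx0 !mul0mx !addr0 !add0r (unitarymxP (UA g)) (unitarymxP (UB g)).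
  by rewrite -scalar_mx_block.
rewrite mulmx_block scale_block_mx !mulmx0 !mul0mx !addr0 !add0r.
by rewrite MA MB !scaler0.
Qed.

Lemma twisted_dim1 (b : gT -> C) : (forall g, `|b g| = 1) ->
  (forall g h, b g * b h = w g h * b (g * h)%g) -> twisted_dim 1.
Proof.
move=> b1 bM; exists (fun g => (b g)%:M); split=> [g|g h].
  by apply/unitarymxP; rewrite tr_scalar_mx map_scalar_mx -scalar_mxM normM_conj.
by rewrite -scalar_mxM bM scale_scalar_mx.
Qed.

Section Induction.
Variables (H : {group gT}) (v : gT -> C).
Hypothesis v1 : forall g, `|v g| = 1.
Hypothesis vM : {in H &, forall p q, v p * v q = w p q * v (p * q)%g}.

(* Twisting [w] by the coboundary of [theta] makes it invariant along [H]:
   [phase g x] below depends only on the coset [H x]. *)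
Let rep x : gT := repr (H :* x)%g.
Let theta (x : gT) : C := v (x * (rep x)^-1)%g / w (x * (rep x)^-1)%g (rep x).

Let norm_theta (x : gT) : `|theta x| = 1.
Proof. by rewrite normrM normfV v1 w1 invr1 mulr1. Qed.

Let w_neq0 g h : w g h != 0. Proof. by rewrite -normr_eq0 w1 oner_eq0. Qed.
Let theta_neq0 (g : gT) : theta g != 0.
Proof. by rewrite -normr_eq0 norm_theta oner_eq0. Qed.
Let v_neq0 g : v g != 0. Proof. by rewrite -normr_eq0 v1 oner_eq0. Qed.

(** With [x = p * t], [t] the coset representative and [p] in [H], [theta x] is [v p / w p t]; the
    cocycle identity at [(q, p, t)] and [vM] conclude. *)
Let thetaM q x : q \in H -> w q x * theta (q * x)%g = v q * theta x.
Proof.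
move=> qH.
have rE : rep (q * x)%g = rep x by rewrite /rep rcosetM rcoset_id.
rewrite /theta rE; set t := rep x; set p := (x * t^-1)%g.
have pH : p \in H.
  have /rcosetP[h hH E] : rep x \in (H :* x)%g := mem_repr_rcoset H x.
  by rewrite /p /t E invMg mulKVg groupV.
have -> : (q * x * t^-1 = q * p)%g by rewrite /p mulgA.
have xE : x = (p * t)%g by rewrite /p mulgKV.
have cE := w_cocycle q p t; rewrite -xE in cE.
have E : w q x / w (q * p)%g t = w q p / w p t.
  by apply/eqP; rewrite eqr_div // cE mulrC.
by rewrite [RHS]mulrA vM // mulrCA E (mulrC (w q p) (v _)) mulrA.
Qed.

Let cosets := {K : {set gT} | K \in rcosets H [set: gT]}.

Let act_subproof (g : gT) (K : cosets) : (val K :* g)%g \in rcosets H [set: gT].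
Proof.
case: K => /= K /rcosetsP[x _ ->]; rewrite -rcosetM.
by apply/rcosetsP; exists (x * g)%g; rewrite ?inE.
Qed.

Let act g K : cosets :=
  exist (fun A => A \in rcosets H [set: gT]) _ (act_subproof g K).

Let phase (g x : gT) : C := w x g * theta (x * g)%g / theta x.

Let norm_phase (g x : gT) : `|phase g x| = 1.
Proof. by rewrite /phase normrM normrM normfV !norm_theta w1 invr1 !mulr1. Qed.

Let phase_coset (g x y : gT) : y \in (H :* x)%g -> phase g y = phase g x.
Proof.
case/rcosetP => q qH ->; rewrite /phase -mulgA.
have thetaE z : theta (q * z)%g = v q * theta z / w q z.
  by rewrite -thetaM // mulrAC divff ?mul1r.
have wE : w (q * x)%g g = w x g * w q (x * g)%g / w q x.
  by rewrite -w_cocycle mulrAC divff ?mul1r.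
rewrite !thetaE wE; field.
by rewrite !w_neq0 v_neq0 theta_neq0.
Qed.

(** Induction of the one-dimensional [v] from [H], written monomially on right cosets. *)
Lemma induced_twisted_dim : twisted_dim #|[set: gT] : H|%g.
Proof.
rewrite /indexg.
have -> : #|rcosets H [set: gT]| = #|{: cosets}|.
  by rewrite card_sig; apply: eq_card => K; rewrite !inE.
have reprK (K : cosets) : val K = (H :* repr (val K))%g.
  case: K => /= K /rcosetsP[x _ ->]; apply/rcoset_eqP.
  by rewrite rcoset_sym (mem_repr_rcoset H x).
exists (twisted_mx act (fun g K => phase g (repr (val K)))).
apply: twisted_mx_rep => [g K K' /(congr1 val)/= E|g h K|g K|g h K].
- by apply/val_inj; rewrite -[val K](rcosetK g) E rcosetK.
- by apply/val_inj; rewrite /= rcosetM.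
- exact: norm_phase.
set x := repr (val K).
(* [x * g] lies in the translated coset but may differ from its chosen [repr]. *)
rewrite (@phase_coset h (x * g)%g); last first.
  have -> : val (act g K) = (H :* (x * g))%g by rewrite /= [in LHS]reprK rcosetM.
  exact: mem_repr_rcoset.
rewrite /phase -mulgA.
have -> : w (x * g)%g h = w g h * w x (g * h)%g / w x g.
  by rewrite -w_cocycle mulrAC divff ?mul1r.
by field; rewrite w_neq0 !theta_neq0.
Qed.

End Induction.

End TwistedDimensions.

(** * Sylow subgroups and dimensions that are powers of [n] *)

Section PowerDimensions.
Variables (C : numClosedFieldType) (gT : finGroupType) (w : gT -> gT -> C).
Hypothesis w1 : forall g h, `|w g h| = 1.
Hypothesis w_cocycle :
  forall g h k, w g h * w (g * h)%g k = w h k * w g (h * k)%g.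

Lemma norm1_neq0 (z : C) : `|z| = 1 -> z != 0.
Proof. by move=> z1; rewrite -normr_eq0 z1 oner_eq0. Qed.

Lemma trivial_on_coprime_subgroup (H : {group gT}) (K : nat) (b : gT -> C) :
  (0 < K)%N -> coprime K #|H| -> (forall g, `|b g| = 1) ->
  (forall g h, b g * b h = w g h ^+ K * b (g * h)%g) ->
  exists2 v : gT -> C, forall g, `|v g| = 1 &
    {in H &, forall p q, v p * v q = w p q * v (p * q)%g}.
Proof.
move=> K0 cK b1 bM.
(* Multiplying the cocycle identity over its last argument in [H] shows that [#|H|] kills the class
   of [w] on [H]. *)
pose m g := \prod_(x in H) w g x.
have m1 g : `|m g| = 1 by rewrite normr_prod big1.
have mM : {in H &, forall p q, m p * m q = w p q ^+ #|H| * m (p * q)%g}.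
  move=> p q pH qH; rewrite /m.
  have -> : \prod_(x in H) w p x = \prod_(x in H) w p (q * x)%g.
    by rewrite (reindex_inj (mulgI q)); apply: eq_bigl => x; rewrite groupMl.
  rewrite -prodr_const -!big_split /=.
  by apply: eq_bigr => x _; rewrite mulrC w_cocycle.
(* By Bezout [u * K - s * #|H| = 1], so [b ^+ u / m ^+ s] trivialises [w] itself on [H]. *)
have [u s us _] := egcdnP #|H| K0.
have {}us : (u * K = s * #|H| + 1)%N by rewrite us (eqP cK).
exists (fun g => b g ^+ u / m g ^+ s) => [g|p q pH qH].
  by rewrite normrM normfV !normrX b1 m1 !expr1n invr1 mulr1.
have E1 : b p ^+ u * b q ^+ u = w p q ^+ (s * #|H|) * w p q * b (p * q)%g ^+ u.
  by rewrite -exprMn bM exprMn -exprM mulnC us exprD expr1.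
have E2 : m p ^+ s * m q ^+ s = w p q ^+ (s * #|H|) * m (p * q)%g ^+ s.
  by rewrite -exprMn mM // exprMn -exprM mulnC.
rewrite mulrACA -invfM E1 E2.
have W0 := expf_neq0 (s * #|H|) (norm1_neq0 (w1 p q)).
field; rewrite W0 expf_neq0 //; exact: norm1_neq0.
Qed.

Lemma twisted_dim_power (n k : nat) (b : gT -> C) : (forall g, `|b g| = 1) ->
  (forall g h, b g * b h = w g h ^+ (n ^ k)%N * b (g * h)%g) ->
  exists j, twisted_dim w (n ^ j).
Proof.
move=> b1 bM; have [n0|n_gt0] := posnP n.
  (* The exponent has to be positive, since [0 ^ 0] is 1. *)
  by exists 1%N; rewrite n0; exact: twisted_dim0.
have [n1|n_neq1] := eqVneq n 1%N.
  exists 0%N; rewrite expn0; apply: (twisted_dim1 b1) => g h.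
  by rewrite bM n1 exp1n expr1.
have K0 : (0 < n ^ k)%N by rewrite expn_gt0 n_gt0.
apply: power_in_additive_monoid.
- by rewrite ltn_neqAle eq_sym n_neq1.
- exact: twisted_dim0.
- exact: twisted_dimD.
(* Inducing from the trivial subgroup provides a positive dimension. *)
- have [|v v1 vM] := trivial_on_coprime_subgroup (H := 1%G) K0 _ b1 bM.
    by rewrite cards1 coprimen1.
  exists #|[set: gT] : 1%G|%g; last exact: induced_twisted_dim vM.
  exact: indexg_gt0.
- move=> q qp qn; have [P sylP] := Sylow_exists q [set: gT]%G.
  have [|v v1 vM] := trivial_on_coprime_subgroup (H := P) K0 _ b1 bM.
    rewrite (card_Hall sylP) p_part coprimeXl // coprimeXr //.
    by rewrite coprime_sym prime_coprime.
  exists #|[set: gT] : P|%g; first exact: induced_twisted_dim vM.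
  by case/and3P: sylP => _ _; rewrite p'natE.
Qed.

End PowerDimensions.

(** * Passing between level sequences and matrices *)

Section Transfer.
Variable R : realType.
Local Notation C := (R[i]).
Local Notation dim := Defs.dim.

Lemma cabs2E (z : C) : ((cabs2 z)%:C)%C = `|z| ^+ 2.
Proof. exact: add_Re2_Im2. Qed.

Lemma cabs2_eq1 (z : C) : cabs2 z = 1 <-> `|z| = 1.
Proof.
split=> [z1|z1].
  apply/eqP; rewrite -(@eqrXn2 _ 2) ?normr_ge0 // expr1n -cabs2E z1.
  by [].
by apply/complexI; rewrite cabs2E z1 expr1n.
Qed.

Lemma cnorm2E m (v : 'cV[C]_m) : ((cnorm2 v)%:C)%C = sqn v.
Proof. by rewrite rmorph_sum; apply: eq_bigr => i _; rewrite -cabs2E. Qed.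

Lemma opnorm_leE m (A : 'M[C]_m) (e : R) :
  opnorm_le A e <-> forall v, sqn (A *m v) <= ((e%:C)%C) ^+ 2 * sqn v.
Proof.
by split=> H v; have := H v; rewrite -!cnorm2E -rmorphXn -rmorphM /= lecR.
Qed.

Lemma adjmxE m (A : 'M[C]_m) : adjmx A = A^t*.
Proof. by rewrite /adjmx -map_trmx; apply/matrixP => i j; rewrite !mxE. Qed.

(** [sqn (A x) - sqn x] is the form of [A^t* A - 1] at [x], which Cauchy-Schwarz bounds by
    [2^-1 * sqn x]. *)
Lemma sqn_near_isometry m (A : 'M[C]_m) :
  (forall x, sqn ((A^t* *m A - 1%:M) *m x) <= 2^-1 ^+ 2 * sqn x) ->
  forall x, 2^-1 * sqn x <= sqn (A *m x).
Proof.
move=> H x; pose z := (x^t* *m ((A^t* *m A - 1%:M) *m x)) 0 0.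
have zE : z = sqn (A *m x) - sqn x.
  by rewrite sqn_mul sqnE /z mulmxBl mul1mx mulmxBr !mxE.
have z_le : `|z| <= 2^-1 * sqn x.
  rewrite -(@ler_pXn2r _ 2) ?nnegrE ?mulr_ge0 ?invr_ge0 ?ler0n ?sqn_ge0 //.
  apply: le_trans (sqn_CauchySchwarz _ _) _.
  by rewrite exprMn mulrC expr2 [X in _ <= X]mulrA ler_wpM2r ?sqn_ge0 // H.
have zr : z \is Num.real by rewrite zE rpredB ?ger0_real ?sqn_ge0.
have := z_le; rewrite real_ler_norml // => /andP[+ _].
rewrite zE lerBrDr -mulNr -[X in _ + X]mul1r -mulrDl.
suff -> : - 2^-1 + 1 = 2^-1 :> C by [].
by field.
Qed.

Variable n : nat.

Lemma up1M k (A B : 'M[C]_(dim n k)) : up1 (A *m B) = up1 A *m up1 B.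
Proof. by rewrite /up1 tensmx_mul mulmx1. Qed.

Lemma up1Z k c (A : 'M[C]_(dim n k)) : up1 (c *: A) = c *: up1 A.
Proof. by apply/matrixP => i j; rewrite !mxE mulrCA. Qed.

Lemma up1_adj k (A : 'M[C]_(dim n k)) : up1 (adjmx A) = adjmx (up1 A).
Proof.
rewrite /up1 /adjmx map_mxT trmx_tens; congr (_ *t _).
by rewrite map_mx1 trmx1.
Qed.

Lemma up1_1 k : up1 (1%:M : 'M[C]_(dim n k)) = 1%:M.
Proof.
apply/matrixP => i j; case: (mxtens_indexP i) => i0 i1.
case: (mxtens_indexP j) => j0 j1.
by rewrite tensmxE !mxE (can_eq (@mxtens_indexK _ _)) xpair_eqE -natrM mulnb.
Qed.

(** [conform_mx] returns [S] at [k = j] without a type cast; the values below level [j] do not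
    affect the limit. *)
Fixpoint constant_lvlseq j (S : 'M[C]_(dim n j)) k : 'M[C]_(dim n k) :=
  if (k <= j)%N then conform_mx 1%:M S else
  match k with 0 => 1%:M | k'.+1 => up1 (constant_lvlseq S k') end.

Lemma constant_lvlseq_base j (S : 'M[C]_(dim n j)) : constant_lvlseq S j = S.
Proof. by case: j S => [|j] S /=; rewrite ?ltnSn ?leqnn conform_mx_id. Qed.

Lemma constant_lvlseqS j (S : 'M[C]_(dim n j)) k : (j <= k)%N ->
  constant_lvlseq S k.+1 = up1 (constant_lvlseq S k).
Proof. by move=> jk; rewrite /= ltnNge jk. Qed.

Lemma constant_lvlseqE j (S : 'M[C]_(dim n j)) d :
  constant_lvlseq S (d + j) = up_by d S.
Proof.
elim: d => [|d IH]; first exact: constant_lvlseq_base.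
by rewrite (constant_lvlseqS S (leq_addl d j)) IH.
Qed.

Lemma constant_lvlseq_up j (S : 'M[C]_(dim n j)) k d : (j <= k)%N ->
  up_by d (constant_lvlseq S k) = constant_lvlseq S (d + k).
Proof.
by move=> jk; elim: d => //= d ->; rewrite ltnNge (leq_trans jk) ?leq_addl.
Qed.

Lemma up_byM d k (A B : 'M[C]_(dim n k)) :
  up_by d (A *m B) = up_by d A *m up_by d B.
Proof. by elim: d => //= d ->; rewrite up1M. Qed.

Lemma up_byZ d k c (A : 'M[C]_(dim n k)) : up_by d (c *: A) = c *: up_by d A.
Proof. by elim: d => //= d ->; rewrite up1Z. Qed.

Lemma up_by_adj d k (A : 'M[C]_(dim n k)) :
  up_by d (adjmx A) = adjmx (up_by d A).
Proof. by elim: d => //= d ->; rewrite up1_adj. Qed.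

Lemma up_by_1 d k : up_by d (1%:M : 'M[C]_(dim n k)) = 1%:M.
Proof. by elim: d => //= d ->; rewrite up1_1. Qed.

Lemma opnorm_le0 m (e : R) : opnorm_le (0 : 'M[C]_m) e.
Proof.
apply/opnorm_leE => v; rewrite mul0mx -(scale0r 0) sqnZ normr0 expr0n mul0r.
by rewrite mulr_ge0 ?sqn_ge0 // -rmorphXn ler0c sqr_ge0.
Qed.

Lemma uhf_eq_eventually (a b : lvlseq R n) j :
  (forall d, a (d + j)%N = b (d + j)%N) -> uhf_eq a b.
Proof.
move=> ab e _; exists j => k jk; rewrite -(subnK jk) ab subrr.
exact: opnorm_le0.
Qed.

Lemma constant_lvlseq_unitary j (S : 'M[C]_(dim n j)) :
  S \is unitarymx -> uhf_unitary (constant_lvlseq S).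
Proof.
move=> US; split; [|split].
- move=> e _; exists j => k d jk; rewrite constant_lvlseq_up // subrr.
  exact: opnorm_le0.
- apply: (@uhf_eq_eventually _ _ j) => d.
  rewrite /uhf_mul /uhf_adj /uhf_one constant_lvlseqE -up_by_adj -up_byM.
  by rewrite adjmxE unitary_adjl // up_by_1.
- apply: (@uhf_eq_eventually _ _ j) => d.
  rewrite /uhf_mul /uhf_adj /uhf_one constant_lvlseqE -up_by_adj -up_byM.
  by rewrite adjmxE (unitarymxP US) up_by_1.
Qed.

Variables (gT : finGroupType) (w : gT -> gT -> C).
Hypothesis Hw : is_cocycle w.

Lemma proj_rep_of_twisted_rep j (S : gT -> 'M[C]_(dim n j)) :
  twisted_rep w S ->
  exists u : gT -> lvlseq R n, proj_rep u /\ ob_is u w.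
Proof.
case=> US MS; have [w1 _] := Hw.
have uM g h : uhf_eq (uhf_mul (constant_lvlseq (S g)) (constant_lvlseq (S h)))
    (uhf_scale (w g h) (constant_lvlseq (S (g * h)%g))).
  apply: (@uhf_eq_eventually _ _ j) => d.
  by rewrite /uhf_mul /uhf_scale !constant_lvlseqE -up_byM MS up_byZ.
exists (fun g => constant_lvlseq (S g)); split; first split=> [g|g h].
- exact: constant_lvlseq_unitary.
- by exists (w g h); split; [exact: w1|].
exists w; split=> [g h|]; first by split; [exact: w1|].
exists (fun=> 1); split=> [g|g h]; first by apply/cabs2_eq1; rewrite normr1.
by rewrite invr1 !mulr1.
Qed.

Lemma twisted_rep_of_proj_rep (u : gT -> lvlseq R n) :
  proj_rep u -> ob_is u w ->
  exists k (B : gT -> 'M[C]_(dim n k)), twisted_rep w B.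
Proof.
move=> [Uu _] [c [uc [b [b1 wE]]]]; have [w1 wM] := Hw.
(* Chosen so that [#|gT| * e < 2^-1]; bounds on squared norms involve [e ^+ 2], and
   [(#|gT| * e) ^+ 2] is then below [2^-1] too. *)
pose e : R := (2 * (#|gT|%:R + 1))^-1.
have G0 : 0 <= #|gT|%:R :> R by exact: ler0n.
have e0 : 0 < e by rewrite invr_gt0 mulr_gt0 ?ltr0n // ltr_wpDl.
have uc' (x : gT * gT) : exists K : nat, forall k, (K <= k)%N ->
    opnorm_le (u x.1 k *m u x.2 k - c x.1 x.2 *: u (x.1 * x.2)%g k) e.
  by have [_ /(_ e e0)[K KP]] := uc x.1 x.2; exists K => k /KP.
(* Finitely many pairs in [gT] allow one level [k] for all the relations. *)
have [K KP] := fin_all_exists uc'.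
have h0 : 0 < 2^-1 :> R by rewrite invr_gt0 ltr0n.
have [_ [/(_ _ h0)[K1 K1P] _]] := Uu 1%g.
pose k := maxn K1 (\max_x K x).
(* Rescaling by [b] replaces the cocycle [c] of the lift by [w] itself. *)
pose a g := b g *: u g k.
exists k; apply: (@near_twisted_rep_exact _ _ _ w a (((e%:C)%C) ^+ 2)).
- by move=> g h; apply/cabs2_eq1.
- exact: wM.
- move=> g h x.
  have -> : a g *m a h - w g h *: a (g * h)%g =
      (b g * b h) *: (u g k *m u h k - c g h *: u (g * h)%g k).
    have bn0 : b (g * h)%g != 0 by apply: norm1_neq0; apply/cabs2_eq1.
    rewrite /a -scalemxAl -scalemxAr scalerA scalerBr !scalerA; congr (_ - _ *: _).
    by rewrite wE mulrA mulfVK // mulrC.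
  rewrite -scalemxAl sqnZ normrM !(cabs2_eq1 _).1 // mulr1 expr1n mul1r.
  move: x; apply/opnorm_leE; apply: (KP (g, h)).
  by rewrite leq_max (leq_bigmax (g, h)) orbT.
- move=> x; rewrite /a -scalemxAl sqnZ (cabs2_eq1 _).1 // expr1n mul1r.
  move: x; apply: sqn_near_isometry => x.
  have /opnorm_leE/(_ x) := K1P k (leq_maxl _ _).
  by rewrite /uhf_mul /uhf_adj /uhf_one adjmxE fmorphV rmorph_nat.
- by rewrite -rmorphXn ler0c sqr_ge0.
- rewrite -(rmorph_nat (real_complex R)) -rmorphXn -!rmorphM.
  rewrite -(rmorph_nat (real_complex R) 2) -fmorphV ltcR.
  rewrite mulrA -expr2 -exprMn.
  have eG : #|gT|%:R * e < 2^-1.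
    rewrite /e invfM mulrCA gtr_pMr // ltr_pdivrMr ?mul1r ?ltrDl //.
    by rewrite ltr_wpDl.
  have eG0 : 0 <= #|gT|%:R * e by rewrite mulr_ge0 // ltW.
  rewrite expr2; apply: (le_lt_trans _ eG); rewrite ler_piMr //.
  apply: ltW; apply: (lt_trans eG); rewrite invf_lt1 ?ltr0n //.
  by rewrite ltr1n.
Qed.

End Transfer.

Theorem mainTheorem3 (R : realType) (n : nat) (gT : finGroupType)
    (w : gT -> gT -> R[i]) (Hw : is_cocycle w) :
  (exists u : gT -> lvlseq R n,
      proj_rep u /\ ob_is u w)
  <->
  (exists k : nat, cohomologous (fun g h => w g h ^+ (n ^ k)%N) (fun _ _ => 1)).
Proof.
split=> [[u [Pu Ou]]|[k [b [b1 bM]]]].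
  have [k [B /twisted_rep_det[b [b1 bE]]]] := twisted_rep_of_proj_rep Hw Pu Ou.
  exists k, b; split=> [g|g h]; first exact/cabs2_eq1.
  by rewrite -dimE.
have [w1 wM] := Hw.
have bn g : `|b g| = 1 by apply/cabs2_eq1.
(* [bM] multiplies [w ^+ (n ^ k)] by the coboundary of [b] to get 1, so [w ^+ (n ^ k)] is the
   coboundary of the inverse of [b]. *)
have [|||g h|j] := @twisted_dim_power _ _ w _ _ n k (fun g => (b g)^-1).
- by move=> g h; apply/cabs2_eq1.
- exact: wM.
- by move=> g; rewrite normfV bn invr1.
- rewrite -invfM -[LHS]mul1r [X in X * _](bM g h) mulrA mulrAC mulfK //.
  by rewrite mulf_neq0 ?norm1_neq0.
by rewrite -dimE => -[S /(proj_rep_of_twisted_rep Hw)].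
Qed.
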